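(* Consider the linear program in standard form $\min\{c^\top x : Ax=b,\ x\ge 0\}$ with $A\in\mathbb{R}^{m_1\times d_x}$ of full row rank, $c\in\mathbb{R}^{d_x}$ fixed, and varying right-hand side $b$. Let $\widehat{\mathcal{B}}=\{b^j\}_{j\in[n]}$ be a finite set of right-hand sides and $\widehat{\mathcal{X}}=\{x^\star(b^j)\}_{j\in[n]}$ the corresponding optimal solutions. Let $\mathcal{C}^1,\dots,\mathcal{C}^L$ be the partition of $\widehat{\mathcal{B}}$ into cells (one for each distinct optimal basis $\mathbf{B}^1,\dots,\mathbf{B}^L$ found), and for $j\in[n]$ let $\ell(j)\in[L]$ be the index of the cell containing $b^j$. Then the system of linear inequalities $$\langle u^{\ell(j)}_k, b^i-b^j\rangle + (x^\star(b^j))_k + z^j_k \le (x^\star(b^i))_k + z^i_k,\qquad \langle v^{\ell(j)}_k, b^i-b^j\rangle + z^j_k\le z^i_k,\qquad \text{for all } i,j\in[n],\ k\in[d_x],$$ in the unknowns $u^\ell_k,v^\ell_k\in\mathbb{R}^{m_1}$ ($\ell\in[L]$, $k\in[d_x]$) and $z^j_k\in\mathbb{R}$ ($j\in[n]$, $k\in[d_x]$), has at least one feasible solution. Moreover, choose from each cell $\mathcal{C}^\ell$ one element, denoted $b^\ell$, with its optimal solution $x^\star(b^\ell)$ and with $z^\ell_k$ denoting the $z$-variable attached to that element. Then the policy $\phi$ constructed from a feasible solution by $$(\phi(b))_k=\max_{\ell\in[L]}\Big((u^\ell_k)^\top(b-b^\ell)+(x^\star(b^\ell))_k+z^\ell_k\Big)-\max_{\ell\in[L]}\Big((v^\ell_k)^\top(b-b^\ell)+z^\ell_k\Big),\qquad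 k\in[d_x],$$ satisfies $$\phi(b)=x^\star(b)\quad\text{for all } b\in \mathrm{Conv}(\mathcal{C}^\ell),\ \ell\in[L].$$
   Context: $[a]=\{1,\dots,a\}$; $\mathrm{Conv}(S)$ is the convex hull of a finite set $S$. Right-hand sides lie in a compact set $\mathcal{B}\subset\mathbb{R}^{m_1}$ for which the LP is feasible and has an optimal solution. By the Basis Decomposition Theorem (Walkup and Wets), the cone $\mathrm{pos}(A)=\{Ax: x\ge 0\}$ decomposes into finitely many closed convex polyhedral cones; the $m_1$ columns of $A$ generating the edges of each $m_1$-dimensional cone form a basis matrix $\mathbf{B}$ that is optimal for every $b$ in that cone, i.e. the point with basic components $\mathbf{B}^{-1}b$ and nonbasic components $0$ is optimal. The resulting optimal solution map $b\mapsto x^\star(b)$ (also written $\phi^\star(b)$) is continuous and piecewise linear, and $x^\star(b)$ denotes the optimal solution given by this map. Cells of the data: $\mathbf{B}^1,\dots,\mathbf{B}^L$ are the distinct optimal bases occurring for the right-hand sides in $\widehat{\mathcal{B}}$, where each $\mathbf{B}^\ell$ is a basis matrix formed by the $m_1$ columns of $A$ generating the edges of one of the $m_1$-dimensional cones in the decomposition of $\mathrm{pos}(A)$ given by the Basis Decomposition Theorem; so $L\le n$. The cell $\mathcal{C}^\ell\subseteq\widehat{\mathcal{B}}$ consists of the elements of $\widehat{\mathcal{B}}$ whose optimal basis is $\mathbf{B}^\ell$, i.e. for which the basic components of $x^\star(b)$ are $(\mathbf{B}^\ell)^{-1}b$ and the nonbasic components are zero. The cells partition $\widehat{\mathcal{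B}}$.
   Formalization: The basis decomposition is assumed to be induced by lifting the columns of A by c, ties broken by a second cost (one is proved to exist); for other decompositions of dual degenerate problems, e.g. c=0 with a non-regular triangulation of pos(A), the system can be infeasible. *)

(* Defs.v *)
From mathcomp Require Import all_boot all_order all_algebra.
From mathcomp Require Import boolp classical_sets reals topology normedtype.

Set Implicit Arguments.
Unset Strict Implicit.
Unset Printing Implicit Defensive.

Import Order.TTheory GRing.Theory Num.Theory.
Import numFieldTopology.Exports numFieldNormedType.Exports.

Local Open Scope classical_set_scope.
Local Open Scope ring_scope.

Section Defs.
Variable R : realType.

Definition dot p (u v : 'cV[R]_p) : R := \sum_(i < p) u i 0 * v i 0.

Definition nneg_vec p : set 'cV[R]_p := [set x | forall i, 0 <= x i 0].

Definition conv_hull (E : lmodType R) (S : set E) : set E :=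
  [set p | exists (k : nat) (lam : 'I_k -> R) (q : 'I_k -> E),
     [/\ forall i, 0 <= lam i, \sum_(i < k) lam i = 1,
         forall i, S (q i) & p = \sum_(i < k) lam i *: q i]].

Definition fin_max L (F : 'I_L.+1 -> R) : R := \big[Num.max/F ord0]_(l < L.+1) F l.

Section LP.
Variables (m d : nat) (A : 'M[R]_(m, d)).
Implicit Types (c w q : 'cV[R]_d) (b : 'cV[R]_m).

Definition feasible b : set 'cV[R]_d := [set x | A *m x = b /\ nneg_vec x].

Definition optimal c b : set 'cV[R]_d :=
  [set x | feasible b x /\ forall y, feasible b y -> dot c x <= dot c y].

(* [pos_on [set: 'I_d]] is pos(A). *)
Definition pos_on (J : {set 'I_d}) : set 'cV[R]_m :=
  [set b | exists2 x, feasible b x & forall k, k \notin J -> x k 0 = 0].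

(* A basis lists the indices of its m columns in increasing order, so that
   distinct bases are distinct sets of columns. *)
Definition lp_basis := {ffun 'I_m -> 'I_d}.
Implicit Types t : lp_basis.

Definition is_basis t : Prop :=
  (forall i j : 'I_m, (i < j)%N -> (t i < t j)%N) /\ colsub t A \in unitmx.

Definition basic_cols t : {set 'I_d} := (t @: [set: 'I_m])%SET.

Definition basis_cone t : set 'cV[R]_m := pos_on (basic_cols t).

(* For an injective t, the sum has one term if k is basic and none otherwise. *)
Definition basic_sol t b : 'cV[R]_d :=
  \col_k \sum_(i < m | t i == k) (invmx (colsub t A) *m b) i 0.

(* T lists the bases of the m-dimensional cones of the decomposition. *)
Definition basis_decomposition c (T : {set lp_basis}) : Prop :=
  [/\ forall t, t \in T -> is_basis t,
      \bigcup_(t in [set` T]) basis_cone t = pos_on [set: 'I_d]%SET,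
      forall s t, s \in T -> t \in T ->
        basis_cone s `&` basis_cone t = pos_on (basic_cols s :&: basic_cols t)%SET
    & forall t b, t \in T -> basis_cone t b -> optimal c b (basic_sol t b)].

Definition reduced_cost t q (k : 'I_d) : R :=
  q k 0 - ((rowsub t q)^T *m invmx (colsub t A) *m col k A) 0 0.

(* The cones of T are the projections of the lower faces of the cone generated
   by the lifted columns (a_k, c_k), ties being broken by a second cost w:
   every basis of T has positive reduced costs for c + e w, for all small e > 0.
   When no nonbasic reduced cost of c vanishes, w is irrelevant.  Under dual
   degeneracy a lower face may be subdivided in many ways into cones of optimal
   bases, and subdivisions that no w induces exist.  For c = 0, every
   triangulation of pos(A) is a basis decomposition; for the non-regular ones the
   inequalities of [policy_system] can be infeasible. *)
Definition lifted c (T : {set lp_basis}) : Prop :=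
  exists w, forall t k, t \in T -> k \notin basic_cols t ->
    0 < reduced_cost t c k \/ (reduced_cost t c k = 0 /\ 0 < reduced_cost t w k).

(* Values outside pos(A) are unconstrained. *)
Definition solution_map (T : {set lp_basis}) (xs : 'cV[R]_m -> 'cV[R]_d) : Prop :=
  forall t b, t \in T -> basis_cone t b -> xs b = basic_sol t b.

End LP.

Section Policy.
Variables (m d n L : nat).
Variables (xs : 'cV[R]_m -> 'cV[R]_d) (b : 'I_n -> 'cV[R]_m).

(* [bs] lists the distinct bases found and [ell j] is the index of the cell of
   [b j].  A point of several cones has several optimal bases; [ell] picks one. *)
Definition cell_structure (A : 'M[R]_(m, d)) (T : {set lp_basis m d})
    (bs : 'I_L -> lp_basis m d) (ell : 'I_n -> 'I_L) : Prop :=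
  [/\ injective bs, forall l, bs l \in T, forall l, exists j, ell j = l
    & forall j, xs (b j) = basic_sol A (bs (ell j)) (b j)].

Variable ell : 'I_n -> 'I_L.

Definition cell (l : 'I_L) : set 'cV[R]_m := [set b j | j in [set j | ell j = l]].

Definition policy_system (u v : 'I_L -> 'I_d -> 'cV[R]_m) (z : 'I_n -> 'I_d -> R) : Prop :=
  forall (i j : 'I_n) (k : 'I_d),
    dot (u (ell j) k) (b i - b j) + xs (b j) k 0 + z j k <= xs (b i) k 0 + z i k /\
    dot (v (ell j) k) (b i - b j) + z j k <= z i k.

End Policy.

(* [rep l] is the index of the element chosen in the cell l. *)
Definition policy m d n L (xs : 'cV[R]_m -> 'cV[R]_d) (b : 'I_n -> 'cV[R]_m)
    (rep : 'I_L.+1 -> 'I_n) (u v : 'I_L.+1 -> 'I_d -> 'cV[R]_m)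
    (z : 'I_n -> 'I_d -> R) (y : 'cV[R]_m) : 'cV[R]_d :=
  \col_k (fin_max (fun l => dot (u l k) (y - b (rep l)) + xs (b (rep l)) k 0 + z (rep l) k)
          - fin_max (fun l => dot (v l k) (y - b (rep l)) + z (rep l) k)).

End Defs.

(* Main.v *)
Require Import Defs.
From mathcomp Require Import all_boot all_order all_algebra.
From mathcomp Require Import boolp classical_sets reals topology normedtype lra.
Import Order.TTheory GRing.Theory Num.Theory.
Import numFieldTopology.Exports numFieldNormedType.Exports.
Local Open Scope classical_set_scope.
Local Open Scope ring_scope.

Set Implicit Arguments.
Unset Strict Implicit.
Unset Printing Implicit Defensive.

(** The key object is a perturbed cost [q = M c + K w], with [w] the tie-breaking
    cost of the lifted decomposition and [M], [K] large.  Every basis of [T] then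
    has reduced costs for [q] as large as desired on its nonbasic columns
    ([lifted_margin]).  Write [p_t] for the dual solution of the basis [t] for
    the cost [q] ([dual_sol]).  For every [x >= 0] with [A x = b],
<<
      q x = p_t b + sum over nonbasic j of (reduced cost of j) x_j
>>
    ([dot_reduced_cost]): [p_t b] underestimates [q x], with equality on the cone
    of [t].  So [b |-> q xs(b)] is convex and piecewise linear, strictly enough to
    absorb other linear functions.

    Solvability of the system ([policy_system_feasible]).  Put
    [z^j_k = q xs(b^j)] and let [v^l_k] be [p_t] for the basis [t] of the cell [l];
    the second inequality is weak duality.  Let [u^l_k] be [p_t] plus the linear
    form [b |-> (basic_sol t b)_k].  The first inequality asks that
    [(basic_sol t b^i)_k - xs(b^i)_k] be at most the duality gap of [t] at [b^i].
    The former is a linear form in the nonbasic entries of [xs(b^i)]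
    ([basic_sol_deviation]), which the gap dominates once the margin of [q] is
    large.

    Interpolation ([policy_eq_solution]).  For any solution of the system, the two
    maxima take the values [xs(b^j)_k + z^j_k] and [z^j_k] at [b^j] and are affine
    on the convex hull of each cell ([fin_max_affine_conv]); their difference is
    then the affine interpolation of [xs], which is [xs] itself because [xs] is
    linear on each cone.

    Existence of a lifted decomposition.  A generic cost [w >= 0] annihilates no
    nonbasic reduced cost ([generic_cost]), and then neither does
    [q = M c + K w].  Let [T] consist of the bases that are dual feasible for
    [q].  They cover [pos(A)] by the dual simplex method, in which every step
    is strict ([exists_covering_bases]).  Two cones meet in a common face because
    the optimal solution for [q] is unique ([basis_cone_setI]).  The method starts
    from a dual feasible point for [c]; that an optimal solution for one right-hand
    side implies its existence follows from the same covering result, applied to a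
    phase-one program ([optimal_dual_feasible]). *)

(** * Bases, basic solutions and reduced costs *)

Section Bases.
Variables (R : realType) (m d : nat) (A : 'M[R]_(m, d)).
Implicit Types (c q w x : 'cV[R]_d) (b : 'cV[R]_m) (t : lp_basis m d).

Lemma dotE p (u v : 'cV[R]_p) : dot u v = (u^T *m v) 0 0.
Proof. by rewrite /dot mxE; apply: eq_bigr => i _; rewrite mxE. Qed.

Lemma dotDl p (u v w : 'cV[R]_p) : dot (u + v) w = dot u w + dot v w.
Proof. by rewrite /dot -big_split; apply: eq_bigr => i _; rewrite mxE mulrDl. Qed.

Lemma dotBr p (u v w : 'cV[R]_p) : dot u (v - w) = dot u v - dot u w.
Proof. by rewrite /dot -sumrB; apply: eq_bigr => i _; rewrite !mxE mulrBr. Qed.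

Lemma mem_basic_cols t i : t i \in basic_cols t.
Proof. exact: imset_f. Qed.

Lemma basisP t : is_basis A t -> injective t.
Proof.
move=> [tmono _] i j tij; apply: val_inj => /=.
by case: (ltngtP i j) => // /tmono; rewrite tij ltnn.
Qed.

(** The simplex multipliers of the basis [t]. *)
Definition dual_sol t q : 'rV[R]_m := (rowsub t q)^T *m invmx (colsub t A).

Definition basic_mx t : 'M[R]_(d, m) := colsub t 1%:M *m invmx (colsub t A).

Lemma basic_solE t b : basic_sol A t b = basic_mx t *m b.
Proof.
apply/colP => k; rewrite -mulmxA !mxE big_mkcond /=.
apply: eq_bigr => i _; rewrite !mxE eq_sym.
by case: eqP => _; rewrite ?mul1r ?mul0r.
Qed.

Lemma colsubE t : colsub t A = A *m colsub t 1%:M.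
Proof. by rewrite mulmx_colsub mulmx1. Qed.

Lemma mulmx_basic_sol t b : is_basis A t -> A *m basic_sol A t b = b.
Proof.
move=> [_ At]; rewrite basic_solE !mulmxA -colsubE mulmxV // mul1mx //.
Qed.

Lemma basic_sol_nonbasic t b k : k \notin basic_cols t -> basic_sol A t b k 0 = 0.
Proof.
move=> kt; rewrite mxE big_pred0 // => i; apply/negbTE/negP => /eqP tik.
by rewrite -tik mem_basic_cols in kt.
Qed.

Lemma supported_basicE t x : is_basis A t ->
  (forall k, k \notin basic_cols t -> x k 0 = 0) -> x = colsub t 1%:M *m rowsub t x.
Proof.
move=> /basisP tinj x0; apply/colP => k; rewrite mxE.
have [/imsetP[i _ ->]|kt] := boolP (k \in basic_cols t).
  rewrite (bigD1 i) //= big1 ?addr0 => [|j ji]; rewrite !mxE ?eqxx ?mul1r //.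
  by rewrite (inj_eq tinj) eq_sym (negbTE ji) mul0r.
rewrite x0 // big1 // => i _; rewrite !mxE.
by case: eqP => [kti|_]; [rewrite kti mem_basic_cols in kt | rewrite mul0r].
Qed.

Lemma basic_sol_unique t b x : is_basis A t -> A *m x = b ->
  (forall k, k \notin basic_cols t -> x k 0 = 0) -> x = basic_sol A t b.
Proof.
move=> tB Axb x0; have xE := supported_basicE tB x0.
rewrite {1}xE basic_solE -mulmxA; congr (_ *m _).
have: A *m (colsub t 1%:M *m rowsub t x) = b by rewrite -xE.
rewrite mulmxA -colsubE => <-.
by rewrite mulmxA mulVmx ?mul1mx //; case: tB.
Qed.

Lemma basis_coneP t b : is_basis A t ->
  basis_cone A t b <-> nneg_vec (basic_sol A t b).
Proof.
move=> tB; split.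
  by move=> [x [Axb x0] xs]; rewrite -(basic_sol_unique tB Axb xs).
move=> b0; exists (basic_sol A t b).
  by split=> //; exact: mulmx_basic_sol.
exact: basic_sol_nonbasic.
Qed.

Lemma reduced_costE t q k : reduced_cost A t q k = q k 0 - (dual_sol t q *m A) 0 k.
Proof.
by rewrite /reduced_cost -/(dual_sol t q) colE mulmxA -colE; congr (_ - _); rewrite mxE.
Qed.

Lemma dual_sol_colsub t q : is_basis A t ->
  dual_sol t q *m colsub t A = (rowsub t q)^T.
Proof. by move=> [_ At]; rewrite -mulmxA mulVmx ?mulmx1. Qed.

Lemma dual_sol_unique t q (pi : 'rV[R]_m) : is_basis A t ->
  (forall i, (pi *m A) 0 (t i) = q (t i) 0) -> pi = dual_sol t q.
Proof.
move=> [_ At] piq; rewrite -[pi](mulmxK At); congr (_ *m _).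
by rewrite mulmx_colsub; apply/rowP => i; rewrite !mxE -piq mxE.
Qed.

Lemma reduced_cost_basic t q k : is_basis A t -> k \in basic_cols t ->
  reduced_cost A t q k = 0.
Proof.
move=> tB /imsetP[i _ ->]; rewrite reduced_costE; apply/eqP; rewrite subr_eq0.
have /rowP/(_ i) := dual_sol_colsub q tB.
by rewrite mulmx_colsub !mxE => ->.
Qed.

(** Eliminating the basic variables from the objective.  With nonnegative reduced
    costs and [x >= 0], this is weak duality together with the duality gap. *)
Lemma dot_reduced_cost t q x :
  dot q x = (dual_sol t q *m (A *m x)) 0 0 + \sum_k reduced_cost A t q k * x k 0.
Proof.
rewrite mulmxA mxE -big_split; apply: eq_bigr => k _ /=.
by rewrite reduced_costE mulrBl addrCA subrr addr0.
Qed.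

Lemma dot_basic_sol t q b : is_basis A t ->
  dot q (basic_sol A t b) = (dual_sol t q *m b) 0 0.
Proof.
move=> tB; rewrite (dot_reduced_cost t) mulmx_basic_sol // big1 ?addr0 // => k _.
have [kt|kt] := boolP (k \in basic_cols t).
  by rewrite reduced_cost_basic // mul0r.
by rewrite basic_sol_nonbasic // mulr0.
Qed.

Lemma reduced_costD t q w k :
  reduced_cost A t (q + w) k = reduced_cost A t q k + reduced_cost A t w k.
Proof.
rewrite !reduced_costE /dual_sol linearD linearD !mulmxDl !mxE.
by rewrite opprD addrACA.
Qed.

Lemma reduced_costZ t a q k :
  reduced_cost A t (a *: q) k = a * reduced_cost A t q k.
Proof. by rewrite !reduced_costE /dual_sol !linearZ /= -!scalemxAl !mxE mulrBr. Qed.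

End Bases.

(** * Lifted families of bases *)

(** [K] makes the pairs with [al i = 0] large enough; [M] then outweighs [K] on
    the pairs with [al i > 0]. *)
Lemma lex_weights (R : realType) (I : finType) (al be C : I -> R) :
  exists M K, [/\ 0 <= M, 0 <= K
    & forall i, 0 < al i \/ al i = 0 /\ 0 < be i -> C i <= M * al i + K * be i].
Proof.
pose K := \sum_i `|C i / be i|.
have K0 : 0 <= K by apply: sumr_ge0 => i _.
pose M := \sum_i (`|C i| + K * `|be i|) / `|al i|.
have M0 : 0 <= M by apply: sumr_ge0 => i _; rewrite divr_ge0 // addr_ge0 // mulr_ge0.
exists M, K; split=> // i [ai|[-> bi]].
  have Mi : (`|C i| + K * `|be i|) / al i <= M.
    rewrite /M (bigD1 i) //= -[al i in leLHS]gtr0_norm // lerDl.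
    by apply: sumr_ge0 => j _; rewrite divr_ge0 // addr_ge0 // mulr_ge0.
  rewrite ler_pdivrMr // in Mi; rewrite -lerBlDr.
  apply: le_trans Mi; apply: lerD; first exact: ler_norm.
  by rewrite -mulrN ler_wpM2l // -normrN ler_norm.
rewrite mulr0 add0r -ler_pdivrMr //; apply: le_trans (ler_norm _) _.
by rewrite /K (bigD1 i) //= lerDl; apply: sumr_ge0.
Qed.

Section Lifted.
Variables (R : realType) (m d : nat) (A : 'M[R]_(m, d)).
Implicit Types (c q w x : 'cV[R]_d) (b : 'cV[R]_m) (t : lp_basis m d).

Lemma lifted_reduced_cost_ge0 c (T : {set lp_basis m d}) t k :
  (forall t, t \in T -> is_basis A t) -> lifted A c T -> t \in T ->
  0 <= reduced_cost A t c k.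
Proof.
move=> TB [w Tw] tT; have [kt|kt] := boolP (k \in basic_cols t).
  by rewrite (reduced_cost_basic _ (TB t tT) kt).
by have [/ltW//|[-> _]] := Tw t k tT kt.
Qed.

(** A single cost of the form [M c + K w] sees every basis of [T] as dual
    nondegenerate, by as large a margin as desired. *)
Lemma lifted_margin c (T : {set lp_basis m d}) (C : lp_basis m d -> 'I_d -> R) :
  lifted A c T ->
  exists q, forall t k, t \in T -> k \notin basic_cols t ->
    C t k <= reduced_cost A t q k.
Proof.
move=> [w Tw].
have [M [K [_ _ MK]]] := lex_weights (fun i => reduced_cost A i.1 c i.2)
  (fun i => reduced_cost A i.1 w i.2) (fun i => C i.1 i.2).
exists (M *: c + K *: w) => t k tT kt.
by rewrite reduced_costD !reduced_costZ; apply: (MK (t, k)); exact: Tw.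
Qed.

Lemma dual_sol_optimal c t b : is_basis A t ->
  (forall k, 0 <= reduced_cost A t c k) -> basis_cone A t b ->
  optimal A c b (basic_sol A t b).
Proof.
move=> tB c0 /(basis_coneP _ tB) b0; split.
  by split=> //; exact: mulmx_basic_sol.
move=> y [Ay y0]; rewrite dot_basic_sol // (dot_reduced_cost A t c y) Ay lerDl.
by apply: sumr_ge0 => k _; rewrite mulr_ge0.
Qed.

Lemma pos_onS (J J' : {set 'I_d}) b : J \subset J' -> pos_on A J b -> pos_on A J' b.
Proof.
move=> /fintype.subsetP JJ' [x xb xJ]; exists x => // k kJ'.
by apply: xJ; apply: contra kJ'; exact: JJ'.
Qed.

(** When two cones share [b], their two basic solutions have the same cost for a
    cost under which both bases are strictly optimal; hence each vanishes off
    the other basis. *)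
Lemma basis_cone_setI q s t b : is_basis A s -> is_basis A t ->
  (forall k, 0 <= reduced_cost A s q k) ->
  (forall k, 0 <= reduced_cost A t q k) ->
  (forall k, k \notin basic_cols t -> 0 < reduced_cost A t q k) ->
  basis_cone A s b -> basis_cone A t b ->
  pos_on A (basic_cols s :&: basic_cols t)%SET b.
Proof.
move=> sB tB s0 t0 tpos sb tb.
have [[Ax x0] xmin] := dual_sol_optimal sB s0 sb.
have [tfeas _] := dual_sol_optimal tB t0 tb.
move: (xmin _ tfeas); rewrite dot_basic_sol // -(dot_basic_sol q b sB).
set x := basic_sol A s b in Ax x0 *.
rewrite dot_basic_sol // (dot_reduced_cost A t) Ax gerDl => xt.
exists x => // k; rewrite inE negb_and => /orP[|kt].
  exact: basic_sol_nonbasic.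
have: reduced_cost A t q k * x k 0 = 0.
  apply/eqP; rewrite eq_le mulr_ge0 // andbT; apply: le_trans xt.
  rewrite (bigD1 k) //= lerDl; apply: sumr_ge0 => j _; rewrite mulr_ge0 //.
by move/eqP; rewrite mulf_eq0 (gt_eqF (tpos k kt)) => /eqP.
Qed.

Lemma lifted_decomposition c (T : {set lp_basis m d}) :
  (forall t, t \in T -> is_basis A t) -> lifted A c T ->
  (forall b, pos_on A [set: 'I_d]%SET b -> exists2 t, t \in T & basis_cone A t b) ->
  basis_decomposition A c T.
Proof.
move=> TB Tlift Tcov; split=> //.
- apply/seteqP; split=> b; last by move=> /Tcov[t tT tb]; exists t.
  by move=> [t _]; apply: pos_onS; exact: finset.subsetT.
- move=> s t sT tT; apply/seteqP; split=> b; last first.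
    by move=> bst; split; apply: pos_onS bst; [exact: finset.subsetIl|exact: finset.subsetIr].
  move=> [sb tb].
  have [q Tq] := lifted_margin (fun _ _ => 1) Tlift.
  have Tq0 r : r \in T -> forall k, 0 <= reduced_cost A r q k.
    move=> rT k; have [kr|kr] := boolP (k \in basic_cols r).
      by rewrite (reduced_cost_basic _ (TB r rT) kr).
    by apply: le_trans (Tq r k rT kr).
  apply: (basis_cone_setI (q := q)) => //; [exact: TB|exact: TB|exact: Tq0|exact: Tq0|].
  by move=> k kt; apply: lt_le_trans (Tq t k tT kt).
- move=> t b tT; apply: dual_sol_optimal; first exact: TB.
  by move=> k; exact: lifted_reduced_cost_ge0 Tlift tT.
Qed.

(** A nonbasic column [a_j] contributes [x_j] times its coordinates in the basis
    minus the unit vector [e_j]; a basic column contributes nothing. *)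
Lemma basic_sol_deviation t x k : is_basis A t -> nneg_vec x ->
  basic_sol A t (A *m x) k 0 - x k 0 <=
  \sum_(j | j \notin basic_cols t)
    (\sum_l `|(basic_mx A t *m A - 1%:M) l j|) * x j 0.
Proof.
move=> tB x0; pose D := basic_mx A t *m A - 1%:M.
have D0 j : j \in basic_cols t -> D k j = 0.
  move=> jt; suff /colP/(_ k) : col j D = 0 by rewrite !mxE.
  rewrite colE mulmxBl mul1mx -mulmxA -basic_solE -(basic_sol_unique _ erefl) ?subrr //.
  by move=> l lt; rewrite mxE; case: eqP => // lj; rewrite lj jt in lt.
have -> : basic_sol A t (A *m x) k 0 - x k 0 = \sum_j D k j * x j 0.
  suff -> : \sum_j D k j * x j 0 = (D *m x) k 0.
    by rewrite mulmxBl mul1mx -mulmxA basic_solE !mxE.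
  by rewrite mxE.
rewrite (bigID (fun j => j \in basic_cols t)) /= big1 ?add0r; last first.
  by move=> j /D0 ->; rewrite mul0r.
apply: ler_sum => j _; apply: ler_wpM2r; first exact: x0.
apply: le_trans (ler_norm _) _; rewrite (bigD1 k) //= lerDl.
exact: sumr_ge0.
Qed.

End Lifted.

(** * The system of inequalities and the policy *)

Section System.
Variables (R : realType) (m d : nat) (A : 'M[R]_(m, d)).

(** A supporting linear form of the convex function [b |-> q xs(b)] serves as [v];
    adding the linear form that gives the [k]-th basic component turns it into [u].
    The margin [C] of [q] makes the duality gap exceed the error of that linear
    form outside its cell. *)
Lemma policy_system_feasible (c : 'cV[R]_d) (T : {set lp_basis m d})
    (xs : 'cV[R]_m -> 'cV[R]_d) (n : nat) (b : 'I_n -> 'cV[R]_m)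
    (L : nat) (bs : 'I_L -> lp_basis m d) (ell : 'I_n -> 'I_L) :
  (forall t, t \in T -> is_basis A t) -> lifted A c T ->
  (forall l, bs l \in T) ->
  (forall j, feasible A (b j) (xs (b j))) ->
  (forall j, xs (b j) = basic_sol A (bs (ell j)) (b j)) ->
  exists u v z, policy_system xs b ell u v z.
Proof.
move=> TB Tlift bsT xsF xsE.
pose C (t : lp_basis m d) j := \sum_l `|(basic_mx A t *m A - 1%:M) l j|.
have [q Tq] := lifted_margin C Tlift.
have gap l i : (dual_sol A (bs l) q *m b i) 0 0 +
    \sum_(j | j \notin basic_cols (bs l)) C (bs l) j * xs (b i) j 0 <= dot q (xs (b i)).
  have [Ax x0] := xsF i.
  rewrite (dot_reduced_cost A (bs l)) Ax lerD2l.
  rewrite [leRHS](bigID (fun j => j \in basic_cols (bs l))) /= [X in _ <= X + _]big1 ?add0r.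
    by apply: ler_sum => j jl; rewrite ler_wpM2r //; exact: Tq.
  by move=> j jl; rewrite (reduced_cost_basic _ (TB _ (bsT l)) jl) mul0r.
exists (fun l k => (dual_sol A (bs l) q)^T + (row k (basic_mx A (bs l)))^T),
  (fun l _ => (dual_sol A (bs l) q)^T), (fun j _ => dot q (xs (b j))).
move=> i j k; have [Ax x0] := xsF i.
have dual_val l y : dot (dual_sol A (bs l) q)^T y = (dual_sol A (bs l) q *m y) 0 0.
  by rewrite dotE trmxK.
have sol_val l y : dot (row k (basic_mx A (bs l)))^T y = basic_sol A (bs l) y k 0.
  by rewrite dotE trmxK -row_mul basic_solE [LHS]mxE.
have -> : dot q (xs (b j)) = (dual_sol A (bs (ell j)) q *m b j) 0 0.
  by rewrite xsE dot_basic_sol //; exact: TB.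
split; rewrite dotBr ?dotDl !dual_val ?sol_val.
  have -> : xs (b j) k 0 = basic_sol A (bs (ell j)) (b j) k 0 by rewrite xsE.
  have := basic_sol_deviation k (TB _ (bsT (ell j))) x0; rewrite Ax.
  have := gap (ell j) i.
  rewrite -/(C (bs (ell j))).
  lra.
rewrite subrK; apply: le_trans (gap (ell j) i); rewrite lerDl.
by apply: sumr_ge0 => r _; rewrite mulr_ge0 // sumr_ge0.
Qed.

End System.

Lemma fin_max_eq (R : realType) L (F : 'I_L.+1 -> R) l :
  (forall l', F l' <= F l) -> fin_max F = F l.
Proof.
move=> Fl; apply/eqP; rewrite eq_le; apply/andP; split.
  by apply: bigmax_le => [|l' _]; exact: Fl.
exact: le_bigmax.
Qed.

(** The inequalities say that the affine piece of the cell of [b j] takes the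
    value [h j] at [b j] and stays below [h i] at every other [b i].  So all pieces of
    one cell coincide on that cell, and there they dominate the pieces of the
    other cells; both facts extend to convex combinations. *)
Lemma fin_max_affine_conv (R : realType) (m n L : nat) (b : 'I_n -> 'cV[R]_m)
    (ell : 'I_n -> 'I_L.+1) (rep : 'I_L.+1 -> 'I_n) (u : 'I_L.+1 -> 'cV[R]_m)
    (h : 'I_n -> R) l p (lam : 'I_p -> R) (f : 'I_p -> 'I_n) :
  (forall i j, dot (u (ell j)) (b i - b j) + h j <= h i) ->
  (forall l, ell (rep l) = l) ->
  (forall i, 0 <= lam i) -> \sum_i lam i = 1 -> (forall i, ell (f i) = l) ->
  fin_max (fun l' => dot (u l') (\sum_i lam i *: b (f i) - b (rep l')) + h (rep l'))
    = \sum_i lam i * h (f i).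
Proof.
move=> hle repK lam0 lam1 fl.
have pieceE l' :
    dot (u l') (\sum_i lam i *: b (f i) - b (rep l')) + h (rep l') =
    \sum_i lam i * (dot (u l') (b (f i) - b (rep l')) + h (rep l')).
  under [RHS]eq_bigr do rewrite mulrDr.
  rewrite big_split /= -mulr_suml lam1 mul1r; congr (_ + _).
  have {1}-> : b (rep l') = \sum_i lam i *: b (rep l').
    by rewrite -scaler_suml lam1 scale1r.
  rewrite -sumrB dotE mulmx_sumr summxE; apply: eq_bigr => i _.
  by rewrite -scalerBr -scalemxAr mxE dotE.
have piece_le l' i : dot (u l') (b i - b (rep l')) + h (rep l') <= h i.
  by have := hle i (rep l'); rewrite repK.
have piece_eq i : dot (u l) (b (f i) - b (rep l)) + h (rep l) = h (f i).
  apply/eqP; rewrite eq_le piece_le /=.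
  have := hle (rep l) (f i); rewrite fl -opprB !dotE mulmxN mxE -lerBrDl opprK.
  by rewrite addrC.
rewrite (fin_max_eq (l := l)) pieceE; first by under eq_bigr do rewrite piece_eq.
by move=> l'; rewrite pieceE; apply: ler_sum => i _; rewrite ler_wpM2l // piece_eq.
Qed.

Section Policy.
Variables (R : realType) (m d : nat) (A : 'M[R]_(m, d)).

Lemma policy_eq_solution (T : {set lp_basis m d})
    (xs : 'cV[R]_m -> 'cV[R]_d) (n : nat) (b : 'I_n -> 'cV[R]_m)
    (L : nat) (bs : 'I_L.+1 -> lp_basis m d) (ell : 'I_n -> 'I_L.+1)
    (u v : 'I_L.+1 -> 'I_d -> 'cV[R]_m) (z : 'I_n -> 'I_d -> R)
    (rep : 'I_L.+1 -> 'I_n) l y :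
  (forall t, t \in T -> is_basis A t) -> solution_map A T xs ->
  (forall l, bs l \in T) ->
  (forall j, feasible A (b j) (xs (b j))) ->
  (forall j, xs (b j) = basic_sol A (bs (ell j)) (b j)) ->
  policy_system xs b ell u v z -> (forall l, ell (rep l) = l) ->
  conv_hull (cell b ell l) y -> policy xs b rep u v z y = xs y.
Proof.
move=> TB xsT bsT xsF xsE sys repK [p [lam [g [lam0 lam1 gl ->]]]].
have /boolp.choice[f fP] : forall i, exists j, ell j = l /\ b j = g i.
  by move=> i; have [j] := gl i; exists j.
have -> : \sum_i lam i *: g i = \sum_i lam i *: b (f i).
  by apply: eq_bigr => i _; have [_ ->] := fP i.
have fl i : ell (f i) = l by have [] := fP i.
have xsy : xs (\sum_i lam i *: b (f i)) = \sum_i lam i *: xs (b (f i)).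
  have lin : basic_sol A (bs l) (\sum_i lam i *: b (f i)) = \sum_i lam i *: xs (b (f i)).
    rewrite basic_solE mulmx_sumr; apply: eq_bigr => i _.
    by rewrite -scalemxAr xsE fl basic_solE.
  rewrite (xsT (bs l)) // basis_coneP //; last exact: TB.
  move=> k; rewrite lin summxE; apply: sumr_ge0 => i _.
  by rewrite mxE mulr_ge0 //; have [_] := xsF (f i).
rewrite xsy; apply/colP => k; rewrite mxE summxE.
have -> : (fun l' => dot (u l' k) (\sum_i lam i *: b (f i) - b (rep l')) +
      xs (b (rep l')) k 0 + z (rep l') k) =
    (fun l' => dot (u l' k) (\sum_i lam i *: b (f i) - b (rep l')) +
      (xs (b (rep l')) k 0 + z (rep l') k)).
  by apply/funext => l'; rewrite addrA.
rewrite (fin_max_affine_conv (h := fun j => xs (b j) k 0 + z j k) (l := l) (ell := ell)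
           (u := fun l' => u l' k)) //; last first.
  by move=> i j; rewrite addrA; have [] := sys i j k.
rewrite (fin_max_affine_conv (h := fun j => z j k) (l := l) (ell := ell)
           (u := fun l' => v l' k)) //; last first.
  by move=> i j; have [] := sys i j k.
by rewrite -sumrB; apply: eq_bigr => i _; rewrite mxE -mulrBr addrK.
Qed.

End Policy.

(** * Vertices of the dual polyhedron *)

Section Vertices.
Variables (R : realType) (m d : nat) (A : 'M[R]_(m, d)).
Implicit Types (c q w x : 'cV[R]_d) (b : 'cV[R]_m) (t : lp_basis m d).
Implicit Types (pi eta : 'rV[R]_m) (J : {set 'I_d}).

(** A full-rank choice among the columns of [A] with those outside [J] set to
    zero never picks a column outside [J].  The chosen indices are then sorted;
    invertibility only depends on their set. *)
Lemma spanning_basis J :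
  (forall eta, (forall k, k \in J -> (eta *m A) 0 k = 0) -> eta = 0) ->
  exists2 t, is_basis A t & basic_cols t \subset J.
Proof.
move=> Jspan; pose AJ : 'M_(m, d) := \matrix_(i, k) (if k \in J then A i k else 0).
have AJin eta k : k \in J -> (eta *m AJ) 0 k = (eta *m A) 0 k.
  by move=> kJ; rewrite !mxE; apply: eq_bigr => i _; rewrite mxE kJ.
have AJfree : row_free AJ.
  apply: inj_row_free => eta eta0; apply: Jspan => k kJ.
  by rewrite -AJin // eta0 mxE.
have AJfull : row_full AJ^T by rewrite /row_full mxrank_tr.
pose f := fullrankfun AJfull.
have funit : rowsub f AJ^T \in unitmx by exact: fullrowsub_unit.
have finj : injective f by exact: fullrankfun_inj.
have fJ i : f i \in J.
  apply: contraT => fiJ.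
  have: row i (rowsub f AJ^T *m invmx (rowsub f AJ^T)) = 0.
    rewrite row_mul (_ : row i _ = 0) ?mul0mx //.
    by apply/rowP => k; rewrite !mxE (negbTE fiJ).
  rewrite mulmxV // => /rowP/(_ i); rewrite !mxE eqxx => /eqP.
  by rewrite oner_eq0.
pose S := [set f i | i in 'I_m]%SET.
have cardS : #|S| = m by rewrite card_imset // card_ord.
pose t : lp_basis m d := [ffun i => Order.enum_val (cast_ord (esym cardS) i)].
have tS i : t i \in S by rewrite ffunE; exact: Order.EnumVal.enum_valP.
have tmono (i j : 'I_m) : (i < j)%N -> (t i < t j)%N.
  move=> ij; have mono := leW_mono (Order.le_enum_val (@le_total _ 'I_d) (A := mem S)).
  have := mono (cast_ord (esym cardS) i) (cast_ord (esym cardS) j).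
  by rewrite !ltEord /= !ffunE => ->.
have tcols : basic_cols t = S.
  apply/eqP; rewrite eqEcard; apply/andP; split.
    by apply/fintype.subsetP => _ /imsetP[i _ ->].
  rewrite cardS card_imset ?cardsT ?card_ord // => i j tij; apply: val_inj => /=.
  by case: (ltngtP i j) => // /tmono; rewrite tij ltnn.
exists t; last first.
  by rewrite tcols; apply/fintype.subsetP => _ /imsetP[i _ ->].
split=> //; rewrite -row_free_unit; apply: inj_row_free => eta eta0.
have etaS k : k \in S -> (eta *m A) 0 k = 0.
  rewrite -tcols => /imsetP[i _ ->].
  by move/rowP/(_ i): eta0; rewrite mulmx_colsub !mxE.
have ffree : row_free (rowsub f AJ^T)^T by rewrite row_free_unit unitmx_tr.
apply/eqP; rewrite -(mulmx_free_eq0 _ ffree); apply/eqP/rowP => i.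
rewrite [RHS]mxE -[RHS](etaS (f i)) ?imset_f // -AJin //.
by rewrite !mxE; apply: eq_bigr => j _; rewrite !mxE.
Qed.

Definition dual_feasible q pi := forall k, (pi *m A) 0 k <= q k 0.

Definition tight q pi : {set 'I_d} := [set k | (pi *m A) 0 k == q k 0]%SET.

(** The ratio test: among the columns that [eta] moves towards their bound, one of
    smallest ratio of slack to speed stops the motion. *)
Lemma dual_step q pi eta : dual_feasible q pi ->
  (exists k, 0 < (eta *m A) 0 k) ->
  exists2 a, 0 <= a & dual_feasible q (pi + a *: eta) /\
    exists2 k, 0 < (eta *m A) 0 k & k \in tight q (pi + a *: eta).
Proof.
move=> pifeas [k0 k0pos].
pose ratio k := (q k 0 - (pi *m A) 0 k) / (eta *m A) 0 k.
have valE a k : ((pi + a *: eta) *m A) 0 k = (pi *m A) 0 k + a * (eta *m A) 0 k.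
  by rewrite mulmxDl -scalemxAl [LHS]mxE; congr (_ + _); rewrite mxE.
case: (@arg_minP _ _ _ k0 (fun k => 0 < (eta *m A) 0 k) ratio k0pos) => k kpos kmin.
have rk : 0 <= ratio k by rewrite divr_ge0 ?subr_ge0 // ltW.
exists (ratio k) => //; split.
  move=> j; rewrite valE; have [jpos|jneg] := ltP 0 ((eta *m A) 0 j).
    by rewrite -lerBrDl -ler_pdivlMr //; exact: kmin.
  by apply: le_trans (pifeas j); rewrite gerDl mulr_ge0_le0.
exists k => //; rewrite inE valE /ratio divfK ?(gt_eqF kpos) //.
by rewrite addrC subrK.
Qed.

Lemma dual_ray_blocked b x eta : feasible A b x -> 0 < (eta *m b) 0 0 ->
  exists k, 0 < (eta *m A) 0 k.
Proof.
move=> [Axb x0] etab; apply: contrapT => /forallNP npos; move: etab.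
rewrite -Axb mulmxA mxE ltNge => /negP; apply; apply: sumr_le0 => k _.
by rewrite mulr_le0_ge0 // leNgt; apply/negP/npos.
Qed.

(** Moving inside the dual polyhedron along a direction orthogonal to the tight
    columns, never decreasing the value at [b], makes one more column tight, until
    the tight columns span.  If the value at [b] increases, some column blocks the way
    because the dual values at [b] are bounded; if it does not change, the direction
    may be reversed so that some column does. *)
Lemma dual_vertex q b pi : row_free A -> pos_on A [set: 'I_d]%SET b ->
  dual_feasible q pi ->
  exists t, [/\ is_basis A t, forall k, 0 <= reduced_cost A t q k
    & (pi *m b) 0 0 <= (dual_sol A t q *m b) 0 0].
Proof.
move=> Afree [x xfeas _].
have [N] := ubnP (d - #|tight q pi|); elim: N pi => // N IH pi piN pifeas.
have [Jspan|] := pselect (forall eta,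
    (forall k, k \in tight q pi -> (eta *m A) 0 k = 0) -> eta = 0).
  have [t tB /fintype.subsetP tJ] := spanning_basis Jspan.
  (* A dual point at which the columns of a basis are tight is its dual solution. *)
  have piE : pi = dual_sol A t q.
    apply: dual_sol_unique => // i; apply/eqP.
    by have := tJ _ (mem_basic_cols t i); rewrite inE.
  exists t; split=> [//|k|]; last by rewrite -piE.
  by rewrite reduced_costE -piE subr_ge0; exact: pifeas.
move=> /existsNP[eta0 /not_implyP[eta0J eta0n0]].
have [eta [etaJ etab etapos]] : exists eta,
    [/\ forall k, k \in tight q pi -> (eta *m A) 0 k = 0, 0 <= (eta *m b) 0 0
      & exists k, 0 < (eta *m A) 0 k].
  have neg_val eta k : ((- eta) *m A) 0 k = - (eta *m A) 0 k by rewrite mulNmx mxE.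
  have neg_b eta : ((- eta) *m b) 0 0 = - (eta *m b) 0 0 by rewrite mulNmx mxE.
  have negJ : forall k, k \in tight q pi -> ((- eta0) *m A) 0 k = 0.
    by move=> k kJ; rewrite neg_val eta0J ?oppr0.
  (* The sign of [eta0] is free: increase the value at [b] if it changes, and
     otherwise make some column approach its bound. *)
  case: (ltgtP 0 ((eta0 *m b) 0 0)) => etab.
  - by exists eta0; split=> //; [exact: ltW|exact: (dual_ray_blocked xfeas)].
  - exists (- eta0); split=> //; [|apply: (dual_ray_blocked xfeas)];
      by rewrite neg_b ?oppr_ge0 ?oppr_gt0 // ltW.
  have [k kn0] : exists k, (eta0 *m A) 0 k != 0.
    apply: contrapT => /forallNP k0; apply: eta0n0; apply/eqP.
    rewrite -(mulmx_free_eq0 _ Afree); apply/eqP/rowP => k; rewrite [RHS]mxE.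
    by apply/eqP; apply: contrapT => /negP; exact: k0.
  case: (ltgtP 0 ((eta0 *m A) 0 k)) kn0 => // kpos _.
    by exists eta0; split=> //; [rewrite -etab | exists k].
  exists (- eta0); split=> //; first by rewrite neg_b -etab oppr0.
  by exists k; rewrite neg_val oppr_gt0.
have [a a0 [feas' [k kpos ktight]]] := dual_step pifeas etapos.
have kJ : k \notin tight q pi by apply/negP => /etaJ k0; rewrite k0 ltxx in kpos.
have sub : (k |: tight q pi \subset tight q (pi + a *: eta))%SET.
  rewrite finset.subUset finset.sub1set ktight; apply/fintype.subsetP => j jJ.
  rewrite inE mulmxDl -scalemxAl [X in X == _]mxE [X in _ + X]mxE etaJ // mulr0 addr0.
  by move: jJ; rewrite inE.
have [|t [tB t0 tb]] := IH (pi + a *: eta) _ feas'.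
  have := subset_leq_card sub; rewrite cardsU1 kJ add1n => lt1.
  have := max_card (mem (tight q (pi + a *: eta))); rewrite card_ord => led.
  rewrite -ltnS; apply: leq_trans piN; rewrite ltnS.
  by apply: ltn_sub2l => //; apply: leq_trans led.
exists t; split=> //; apply: le_trans tb.
by rewrite mulmxDl -scalemxAl [leRHS]mxE lerDl mxE mulr_ge0.
Qed.

End Vertices.

(** * Existence of a lifted decomposition *)

Lemma exists_nat_nonroot (R : realType) (p : {poly R}) :
  p != 0 -> exists N : nat, ~~ root p N%:R.
Proof.
move=> p0; apply: contrapT => /forallNP pN.
have := @max_poly_roots _ p [seq i%:R | i <- iota 0 (size p)] p0.
rewrite size_map size_iota ltnn => contra; suff: false by []; apply: contra.
  by apply/allP => _ /mapP[i _ ->]; apply/negPn/negP/pN.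
by rewrite map_inj_uniq ?iota_uniq //; apply: mulrIn; exact: oner_neq0.
Qed.

Section Covering.
Variables (R : realType) (m d : nat) (A : 'M[R]_(m, d)).
Implicit Types (c q w x : 'cV[R]_d) (b : 'cV[R]_m) (t : lp_basis m d).

(** Along [w_k = s ^ k], the reduced cost of a nonbasic [k] is a polynomial in [s]
    whose coefficient of [s ^ k] is [1].  Any natural number [s] that is a root of
    none of these finitely many polynomials will do. *)
Lemma generic_cost : exists w,
  (forall k, 0 <= w k 0) /\
  forall t k, k \notin basic_cols t -> reduced_cost A t w k != 0.
Proof.
pose p t (k : 'I_d) : {poly R} :=
  'X^k - \sum_i (invmx (colsub t A) *m col k A) i 0 *: 'X^(t i).
pose P := \prod_(tk : lp_basis m d * 'I_d | tk.2 \notin basic_cols tk.1) p tk.1 tk.2.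
have P0 : P != 0.
  apply/prodf_neq0 => -[t k] /= kt; apply: contraT => /negPn/eqP/polyP/(_ k).
  rewrite coefB coefXn eqxx coef_sum big1 ?subr0 => [|i _].
    by rewrite coef0 => /eqP; rewrite oner_eq0.
  rewrite coefZ coefXn; case: eqP => [/val_inj kti|]; last by rewrite mulr0.
  by rewrite kti mem_basic_cols in kt.
have [N PN] := exists_nat_nonroot P0.
exists (\col_k N%:R ^+ k); split=> [k|t k kt]; first by rewrite mxE exprn_ge0.
have -> : reduced_cost A t (\col_k N%:R ^+ k) k = (p t k).[N%:R].
  rewrite /reduced_cost -mulmxA mxE hornerD hornerN hornerXn horner_sum.
  congr (_ - _); rewrite mxE; apply: eq_bigr => i _.
  by rewrite hornerZ hornerXn !mxE mulrC.
by move: PN; rewrite rootE horner_prod => /prodf_neq0/(_ (t, k) kt).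
Qed.

(** [lex_weights] is applied to all reduced costs and to their opposites.  So a
    reduced cost for [M c + K w] has the sign of the lexicographic pair of
    reduced costs for [c] and [w], which is never zero since [w] is generic. *)
Lemma lex_cost c w :
  (forall t k, k \notin basic_cols t -> reduced_cost A t w k != 0) ->
  exists M K, [/\ 0 <= M, 0 <= K
    & forall t k, k \notin basic_cols t ->
      0 <= reduced_cost A t (M *: c + K *: w) k ->
      0 < reduced_cost A t (M *: c + K *: w) k /\
      (0 < reduced_cost A t c k \/
       reduced_cost A t c k = 0 /\ 0 < reduced_cost A t w k)].
Proof.
move=> wgen.
pose sg (i : bool * (lp_basis m d * 'I_d)) q :=
  if i.1 then reduced_cost A i.2.1 q i.2.2 else - reduced_cost A i.2.1 q i.2.2.
have [M [K [M0 K0 MK]]] := lex_weights (sg^~ c) (sg^~ w) (fun=> 1).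
exists M, K; split=> // t k kt.
rewrite reduced_costD !reduced_costZ.
have := MK (true, (t, k)); have := MK (false, (t, k)); rewrite /sg /= => neg pos.
have := wgen t k kt.
case: (ltgtP 0 (reduced_cost A t c k)) => c0.
- by move=> _ _; have := pos (or_introl c0) => h; split; [lra|left].
- move=> _; have := neg (or_introl _); rewrite oppr_gt0 => /(_ c0) h; lra.
- case: (ltgtP 0 (reduced_cost A t w k)) => // w0 _.
  + by move=> _; have := pos (or_intror (conj (esym c0) w0)) => h; split; [lra|right].
  + have := neg (or_intror _); rewrite -c0 oppr0 oppr_gt0 => /(_ (conj erefl w0)) h; lra.
Qed.

(** Dual simplex method for a cost that makes every basis dual nondegenerate.
    Among its dual feasible bases, take one of largest dual value at [b].  If a
    basic variable were negative, leaving the dual vertex along the corresponding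
    edge would increase that value, by a step of positive length. *)
Lemma exists_covering_bases c : row_free A ->
  (exists pi, dual_feasible A c pi) ->
  exists T : {set lp_basis m d}, [/\ forall t, t \in T -> is_basis A t, lifted A c T
    & forall b, pos_on A [set: 'I_d]%SET b -> exists2 t, t \in T & basis_cone A t b].
Proof.
move=> Afree [pi0 pi0c].
have [w [w0 wgen]] := generic_cost.
have [M [K [M0 K0 lexq]]] := lex_cost c wgen; set q := M *: c + K *: w in lexq.
pose T : {set lp_basis m d} :=
  [set t | `[< is_basis A t /\ forall k, 0 <= reduced_cost A t q k >]]%SET.
have TP t : t \in T <-> is_basis A t /\ forall k, 0 <= reduced_cost A t q k.
  by rewrite inE; split=> /asboolP.
exists T; split=> [t /TP[]//||b bpos].
  by exists w => t k /TP[_ t0] kt; have [] := lexq t k kt (t0 k).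
have pi0q : dual_feasible A q (M *: pi0).
  move=> k; rewrite -scalemxAl !mxE.
  have := ler_wpM2l M0 (pi0c k); rewrite mxE => /le_trans; apply.
  by rewrite lerDl mulr_ge0.
have [t0 [t0B t0q _]] := dual_vertex Afree bpos pi0q.
have t0T : t0 \in T by apply/TP.
case: (@arg_maxP _ _ _ t0 [in T] (fun t => (dual_sol A t q *m b) 0 0) t0T) => t tT tmax.
exists t => //; have /TP[tB tq] := tT.
apply/basis_coneP => // k; apply: contraT; rewrite -ltNge => kneg.
have kt : k \in basic_cols t.
  by apply: contraT => /(basic_sol_nonbasic A b) k0; rewrite k0 ltxx in kneg.
(* Along this edge the column [k] leaves its bound; the other basic columns stay
   tight. *)
pose eta := - row k (basic_mx A t).
have etab : 0 < (eta *m b) 0 0.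
  by rewrite mulNmx -row_mul -basic_solE 2![in ltRHS]mxE oppr_gt0.
have etat j : j \in basic_cols t -> (eta *m A) 0 j <= 0.
  move=> /imsetP[i _ ->].
  have -> : (eta *m A) 0 (t i) = (eta *m colsub t A) 0 i.
    by rewrite mulmx_colsub [RHS]mxE.
  rewrite mulNmx -row_mul -mulmxA mulVmx ?mulmx1; last by case: tB.
  by rewrite !mxE oppr_le0.
have [x xfeas _] := bpos.
have tfeas : dual_feasible A q (dual_sol A t q).
  by move=> j; rewrite -subr_ge0 -reduced_costE.
have [a a0 [feas' [j jpos jtight]]] := dual_step tfeas (dual_ray_blocked xfeas etab).
have jt : j \notin basic_cols t by apply/negP => /etat; rewrite leNgt jpos.
(* A blocking column is nonbasic, so it has positive slack at the vertex. *)
have apos : 0 < a.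
  rewrite lt_neqAle a0 andbT; apply/eqP => a_eq; move: jtight.
  rewrite -a_eq scale0r addr0 inE eq_sym -subr_eq0 -reduced_costE.
  by have [/gt_eqF -> _] := lexq t j jt (tq j).
have [t' [t'B t'q t'b]] := dual_vertex Afree bpos feas'.
have /tmax : t' \in T by apply/TP.
rewrite /= leNgt => /negP; case; apply: lt_le_trans t'b.
by rewrite mulmxDl -scalemxAl [ltRHS]mxE ltrDl mxE mulr_gt0.
Qed.

End Covering.

(** Phase one.  Maximize [s] subject to [pi A + s <= c] and [s <= 0], a dual program with
    an obvious feasible point.  A covering basis for the right-hand side [(0, 1)]
    gives a dual solution and a primal solution [(y, _)] of equal values [s] and
    [c y], where [A y = 0] and [y >= 0]; moving an optimal solution along [y]
    shows that [c y >= 0].  Hence [s >= 0] and [pi A <= c]. *)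
Lemma optimal_dual_feasible (R : realType) (m d : nat) (A : 'M[R]_(m, d))
    (c : 'cV[R]_d) b x :
  row_free A -> optimal A c b x -> exists pi, dual_feasible A c pi.
Proof.
move=> Afree [[Axb x0] xmin].
pose A' : 'M_(m + 1, d + 1) := block_mx A 0 (const_mx 1) 1%:M.
pose c' : 'cV_(d + 1) := col_mx c 0.
have mulA' (pi : 'rV_m) (s : 'rV_1) :
    row_mx pi s *m A' = row_mx (pi *m A + s *m const_mx 1) s.
  by rewrite mul_row_block mulmx0 add0r mulmx1.
have const1 (s : 'rV[R]_1) k : (s *m (const_mx 1 : 'rV_d)) 0 k = s 0 0.
  by rewrite mxE big_ord_recl big_ord0 addr0 !mxE mulr1.
have A'free : row_free A'.
  apply: inj_row_free => v; rewrite -[v]hsubmxK mulA' -[0 in X in X -> _]row_mx0.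
  move=> /eq_row_mx[+ s0]; rewrite s0 mul0mx addr0 => /eqP.
  by rewrite (mulmx_free_eq0 _ Afree) => /eqP ->; rewrite row_mx0.
have dual0 : dual_feasible A' c' (row_mx 0 (- \sum_k `|c k 0|)%:M).
  move=> k; rewrite mulA' mul0mx add0r; case: (split_ordP k) => i ->.
    rewrite row_mxEl col_mxEu const1 mxE eqxx mulr1n lerNl.
    apply: le_trans (ler_norm _) _; rewrite normrN (bigD1 i) //= lerDl.
    exact: sumr_ge0.
  rewrite row_mxEr col_mxEd !ord1 !mxE eqxx mulr1n oppr_le0.
  exact: sumr_ge0.
have [T [TB Tlift Tcov]] := exists_covering_bases A'free (ex_intro _ _ dual0).
pose b' : 'cV[R]_(m + 1) := col_mx 0 1%:M.
have [t tT tb'] : exists2 t, t \in T & basis_cone A' t b'.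
  apply: Tcov; exists (col_mx 0 1%:M) => [|k]; last by rewrite inE.
  split; first by rewrite mul_block_col !mulmx0 mul0mx addr0 add0r mulmx1.
  move=> k; case: (split_ordP k) => i ->; first by rewrite col_mxEu mxE.
  by rewrite col_mxEd mxE ler0n.
have tB := TB t tT.
have /basis_coneP-/(_ tB) sol0 := tb'.
have := mulmx_basic_sol b' tB; have := dot_basic_sol c' b' tB.
rewrite -[basic_sol _ _ _]vsubmxK in sol0 *.
set y := usubmx _ in sol0 *; set r := dsubmx _ in sol0 *.
rewrite mul_block_col mul0mx addr0 => val /eq_col_mx[Ay _].
have y0 : nneg_vec y by move=> k; have := sol0 (lshift 1 k); rewrite col_mxEu.
have cy : 0 <= dot c y.
  have feas : feasible A b (x + y).
    by split; [rewrite mulmxDr Ay addr0 | move=> k; rewrite mxE addr_ge0].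
  by have := xmin _ feas; rewrite !dotE mulmxDr [leRHS]mxE lerDl.
have tdual k : (dual_sol A' t c' *m A') 0 k <= c' k 0.
  by rewrite -subr_ge0 -reduced_costE; exact: lifted_reduced_cost_ge0 Tlift tT.
move: val tdual; rewrite -[dual_sol A' t c']hsubmxK.
set pi := lsubmx _; set s := rsubmx _ => val tdual.
have s0 : 0 <= s 0 0.
  move: val; rewrite mul_row_col mulmx0 add0r mulmx1 => <-.
  by rewrite dotE tr_col_mx mul_row_col trmx0 mul0mx addr0 -dotE.
exists pi => k; have := tdual (lshift 1 k).
rewrite mulA' row_mxEl col_mxEu [X in X <= _]mxE const1; apply: le_trans.
by rewrite lerDl.
Qed.

(** * Interpolation of the optimal solution map *)

Theorem theorem1 (R : realType) (m d : nat) (A : 'M[R]_(m, d)) (c : 'cV[R]_d)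
  (hA : row_free A)
  (B : set 'cV[R]_m) (hBc : compact B) (hB0 : B !=set0)
  (hBopt : forall b0, B b0 -> optimal A c b0 !=set0) :
  (exists T : {set lp_basis m d}, basis_decomposition A c T /\ lifted A c T) /\
  forall (T : {set lp_basis m d}) (xs : 'cV[R]_m -> 'cV[R]_d),
    basis_decomposition A c T -> lifted A c T -> solution_map A T xs ->
  forall (n : nat) (b : 'I_n -> 'cV[R]_m), (forall j, B (b j)) ->
  forall (L : nat) (bs : 'I_L.+1 -> lp_basis m d) (ell : 'I_n -> 'I_L.+1),
    cell_structure xs b A T bs ell ->
  (exists u v z, policy_system xs b ell u v z) /\
  forall (u v : 'I_L.+1 -> 'I_d -> 'cV[R]_m) (z : 'I_n -> 'I_d -> R)
    (rep : 'I_L.+1 -> 'I_n),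
    policy_system xs b ell u v z -> (forall l, ell (rep l) = l) ->
  forall (l : 'I_L.+1) (y : 'cV[R]_m), conv_hull (cell b ell l) y ->
    policy xs b rep u v z y = xs y.
Proof.
split.
  have [b0 /hBopt[x xopt]] := hB0.
  have [T [TB Tlift Tcov]] :=
    exists_covering_bases hA (optimal_dual_feasible hA xopt).
  by exists T; split=> //; exact: lifted_decomposition.
move=> T xs [TB Tcov _ Topt] Tlift xsT n b bB L bs ell [_ bsT _ xsE].
have xsF j : feasible A (b j) (xs (b j)).
  have [x [xfeas _]] := hBopt _ (bB j).
  have: pos_on A [set: 'I_d]%SET (b j) by exists x => // k; rewrite inE.
  rewrite -Tcov => -[t /= tT tb]; rewrite (xsT t) //.
  by have [] := Topt t _ tT tb.
split; first exact: policy_system_feasible Tlift bsT xsF xsE.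
by move=> u v z rep sys repK l y; exact: (policy_eq_solution TB xsT bsT xsF xsE sys repK).
Qed.
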